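(* (a) For every $\omega\in\mathcal W$ there exists a function $f$ in the same weak equivalence class as $\omega$ which is increasing and such that $\phi(x)=\frac{f(x)}{x}$ is decreasing on $(0,\infty)$. Moreover, every positive continuous function $f$ on $\mathbb R^+$ such that $f(0)=0$, which is weakly equivalent to an element of $\mathcal W$, is increasing, and is such that $\phi(x)=\frac{f(x)}{x}$ is decreasing on $(0,\infty)$, belongs to $\mathcal W$. (b) Every weak equivalence class in $\mathcal W$ contains a concave element.
   Context: $\mathbb R^+=[0,\infty)$. $\mathcal W$ is the set of all nondecreasing continuous functions $\omega:\mathbb R^+\to\mathbb R^+$ such that $\omega(0)=0$; $\omega(x+y)\le\omega(x)+\omega(y)$ for all $x,y\ge 0$; $\int_1^\infty \frac{\omega(t)}{t^2}\,dt<\infty$; and $\lim_{t\to\infty}\frac{\omega(t)}{\log(1+t)}=\infty$. Two functions $\omega_1,\omega_2:\mathbb R^+\to\mathbb R^+$ are weakly equivalent if there exist constants $k,m>0$ such that $k\,\omega_1(t)\le\omega_2(t)\le m\,\omega_1(t)$ for all $t\in\mathbb R^+$. The weak equivalence class of $\omega\in\mathcal W$ is the set of elements of $\mathcal W$ weakly equivalent to $\omega$. ''Positive'' means with values in $\mathbb R^+$; ''increasing'' and ''decreasing'' are understood in the wide (non-strict) sense. *)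

(* Defs.v *)
From HB Require Import structures.
From mathcomp Require Import all_boot all_order all_algebra.
From mathcomp Require Import all_classical all_reals all_analysis.

Set Implicit Arguments.
Unset Strict Implicit.
Unset Printing Implicit Defensive.

Import Order.TTheory GRing.Theory Num.Theory.
Import numFieldNormedType.Exports.

Local Open Scope classical_set_scope.
Local Open Scope ring_scope.

(* A function R^+ -> R^+ is encoded by a total f : R -> R whose values on the
   negative half-line are irrelevant: every predicate below depends only on the
   restriction of f to [0, +oo[. *)

Definition positive_on_Rplus (R : realType) (f : R -> R) : Prop :=
  forall t, 0 <= t -> 0 <= f t.

Definition increasing_on_Rplus (R : realType) (f : R -> R) : Prop :=
  {in `[0, +oo[ &, nondecreasing_fun f}.

Definition continuous_on_Rplus (R : realType) (f : R -> R) : Prop :=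
  {within `[0, +oo[, continuous f}.

(* The class calW.  The integrand is nonnegative on [1, +oo[, so the improper
   integral is the (extended-real) Lebesgue integral. *)
Record weight (R : realType) (w : R -> R) : Prop := Weight {
  weight_positive : positive_on_Rplus w;
  weight_increasing : increasing_on_Rplus w;
  weight_continuous : continuous_on_Rplus w;
  weight_at0 : w 0 = 0;
  weight_subadditive :
    forall x y, 0 <= x -> 0 <= y -> w (x + y) <= w x + w y;
  weight_integral :
    (\int[lebesgue_measure]_(t in `[1%R, +oo[) (w t / t ^+ 2)%:E < +oo)%E;
  weight_log : w t / ln (1 + t) @[t --> +oo] --> +oo }.

Definition weakly_equivalent (R : realType) (f g : R -> R) : Prop :=
  exists k m : R, [/\ 0 < k, 0 < m &
    forall t, 0 <= t -> k * f t <= g t /\ g t <= m * f t].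

Definition weak_class (R : realType) (w : R -> R) : set (R -> R) :=
  [set f | weight f /\ weakly_equivalent w f].

Definition ratio_decreasing (R : realType) (f : R -> R) : Prop :=
  {in `]0, +oo[ &, nonincreasing_fun (fun x => f x / x)}.

Definition concave_on_Rplus (R : realType) (f : R -> R) : Prop :=
  convex_function (`[0, +oo[%classic : set R^o) (fun x => - f x).

(* Main.v *)
Require Import Defs.
From HB Require Import structures.
From mathcomp Require Import all_boot all_order all_algebra.
From mathcomp Require Import all_classical all_reals all_analysis.
From mathcomp Require Import measurable_realfun ring.

Import Order.TTheory GRing.Theory Num.Theory.
Import numFieldNormedType.Exports.

Local Open Scope classical_set_scope.
Local Open Scope ring_scope.

(** The idea is to replace a weight w by its least concave majorant f, the
    infimum of the increasing affine functions lying above w.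

    Subadditivity is what keeps f comparable to w.  For s >= 0 and t > 0,
    covering [0, s] by at most s / t + 1 intervals of length t gives
    w s <= w t + (w t / t) * s ([subadditive_le_affine]): each point t > 0
    carries an affine majorant of w whose value at t is only 2 * w t.  Hence
    w <= f <= 2 * w, so f is weakly equivalent to w.  As an infimum of affine
    functions a + b * t with a, b >= 0, f is also concave and increasing, and
    f t / t, the infimum of the functions a / t + b, is decreasing.

    That f is itself a weight, as is any continuous increasing function with
    decreasing ratio that is weakly equivalent to a weight, is
    [weight_of_ratio_decreasing].  The integral condition and the logarithmic
    growth are insensitive to constant factors, so both pass through weak
    equivalence.  Subadditivity does not pass, but follows from the ratio:
    f (x + y) = x * (f (x + y) / (x + y)) + y * (f (x + y) / (x + y))
    is at most f x + f y.  Finally, an increasing subadditive function that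
    vanishes continuously at 0 is its own modulus of continuity, which makes
    f continuous ([subadditive_continuous]).

    One function f thus serves both existence claims. *)

(** * Subadditive functions on the half-line *)

Lemma subadditive_natmul (R : realType) (w : R -> R) (t : R) :
  (forall x y, 0 <= x -> 0 <= y -> w (x + y) <= w x + w y) ->
  0 <= t -> forall n, w (n.+1%:R * t) <= n.+1%:R * w t.
Proof.
move=> subw t0; elim=> [|n IHn]; first by rewrite !mul1r.
rewrite -addn1 natrD !mulrDl !mul1r.
by apply: le_trans (subw _ _ _ _) _; rewrite ?mulr_ge0 ?lerD2r.
Qed.

(** The interval [0, s] is covered by n + 1 intervals of length t, where n is
    the integer part of s / t, and n + 1 <= s / t + 1.  The right-hand side is
    affine in s, which is what makes it a candidate majorant of w. *)
Lemma subadditive_le_affine (R : realType) (w : R -> R) (s t : R) :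
  positive_on_Rplus w -> increasing_on_Rplus w ->
  (forall x y, 0 <= x -> 0 <= y -> w (x + y) <= w x + w y) ->
  0 <= s -> 0 < t -> w s <= w t + w t / t * s.
Proof.
move=> posw incw subw s0 t0; have wt0 : 0 <= w t by apply/posw/ltW.
have st0 : 0 <= s / t by rewrite divr_ge0// ltW.
have /andP[ns sn] := truncn_itv st0.
apply: (@le_trans _ _ (w ((Num.truncn (s / t)).+1%:R * t))).
  apply: incw; rewrite ?in_itv/= ?andbT ?mulr_ge0// ?(ltW t0)//.
  by rewrite -ler_pdivrMr// ltW.
apply: le_trans (subadditive_natmul _ _ _ subw (ltW t0) _) _.
rewrite mulrAC -mulrA [leRHS](_ : _ = (s / t + 1) * w t); last by ring.
by rewrite ler_wpM2r// -natr1 lerD2r.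
Qed.

(** For y <= x, subadditivity and monotonicity give
    0 <= f x - f y <= f (x - y), so smallness of f near 0 controls its
    oscillation everywhere. *)
Lemma subadditive_continuous (R : realType) (f : R -> R) :
  increasing_on_Rplus f ->
  (forall x y, 0 <= x -> 0 <= y -> f (x + y) <= f x + f y) ->
  (forall e, 0 < e -> exists2 d, 0 < d & f d <= e) ->
  continuous_on_Rplus f.
Proof.
move=> incf subf small.
have modulus x y d : 0 <= x -> 0 <= y -> 0 <= d -> `|x - y| <= d ->
    `|f x - f y| <= f d.
  move=> x0 y0 d0.
  wlog yx : x y x0 y0 / y <= x.
    move=> H xyd; have [yx|/ltW xy] := leP y x; first exact: H.
    by rewrite distrC; apply: H => //; rewrite distrC.
  have fyx : f y <= f x by apply: incf; rewrite ?in_itv/= ?andbT.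
  rewrite ger0_norm ?subr_ge0// ger0_norm ?subr_ge0// => xyd.
  rewrite lerBlDl; apply: le_trans (subf y d y0 d0).
  by apply: incf; rewrite ?in_itv/= ?andbT ?addr_ge0// -lerBlDl.
apply/continuous_within_itvcyP; split=> [x|].
- rewrite in_itv/= andbT => x0; apply/cvgrPdist_le => e e0.
  have [d d0 fd] := small e e0.
  near=> y; apply: le_trans fd; apply: modulus (ltW x0) _ (ltW d0) _.
  + by near: y; exact: lt_le_nbhsr.
  + by near: y; exact: (@cvgr_dist_le _ _ _ _ _ id).
- apply/cvgrPdist_le => e e0; have [d d0 fd] := small e e0.
  near=> y; have y0 : 0 < y by near: y; exact: nbhs_right_gt.
  apply: le_trans fd; apply: modulus (lexx 0) (ltW y0) (ltW d0) _.
  rewrite sub0r normrN gtr0_norm//.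
  by near: y; exact: nbhs_right_le.
Unshelve. all: by end_near. Qed.

(** Split f (x + y) proportionally to x and y; each share z * phi (x + y),
    with phi z = f z / z, is at most z * phi z = f z. *)
Lemma ratio_decreasing_subadditive (R : realType) (f : R -> R) :
  f 0 = 0 -> ratio_decreasing f ->
  forall x y, 0 <= x -> 0 <= y -> f (x + y) <= f x + f y.
Proof.
move=> f0 decf x y; rewrite le_eqVlt => /predU1P[<- _|x0].
  by rewrite f0 !add0r.
rewrite le_eqVlt => /predU1P[<-|y0]; first by rewrite f0 !addr0.
have xy0 : 0 < x + y by rewrite addr_gt0.
have dec z : 0 < z -> z <= x + y -> z * (f (x + y) / (x + y)) <= f z.
  move=> z0 zxy; rewrite mulrC -ler_pdivlMr//.
  by apply: decf; rewrite ?in_itv/= ?andbT.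
rewrite [leLHS](_ : _ = x * (f (x + y) / (x + y)) + y * (f (x + y) / (x + y))).
  by rewrite lerD// dec// ?lerDl ?lerDr ltW.
by rewrite -mulrDl mulrCA divff ?mulr1// gt_eqF.
Qed.

(** * Stability of weights under weak equivalence *)

Lemma measurable_ratio_sqr (R : realType) (f : R -> R) :
  continuous_on_Rplus f ->
  measurable_fun (`[1, +oo[%classic : set R) (fun t => (f t / t ^+ 2)%:E).
Proof.
move=> cf; apply/measurable_EFinP; apply: measurable_funM.
  apply: subspace_continuous_measurable_fun => //.
  apply: continuous_subspaceW cf => x/=; rewrite !in_itv/= !andbT.
  exact: le_trans.
apply: subspace_continuous_measurable_fun => //.
apply: continuous_in_subspaceT => x; rewrite inE/= in_itv/= andbT => x1.
apply: cvgV; last exact: exprn_continuous.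
by rewrite expf_neq0// gt_eqF// (lt_le_trans ltr01).
Qed.

(** When k * f <= w <= m * f, the bound f <= w / k dominates the integral and
    the bound w / m <= f forces the growth at infinity. *)
Lemma weight_of_ratio_decreasing (R : realType) (f w : R -> R) :
  positive_on_Rplus f -> continuous_on_Rplus f -> f 0 = 0 ->
  weight w -> weakly_equivalent f w ->
  increasing_on_Rplus f -> ratio_decreasing f -> weight f.
Proof.
move=> posf cf f0 [posw incw cw w0 subw intw logw] [k [m [k0 m0 fw]]] incf decf.
split=> //.
- exact: ratio_decreasing_subadditive.
- have ge0 g : positive_on_Rplus g ->
      forall t : R, `[1, +oo[%classic t -> (0 <= (g t / t ^+ 2)%:E)%E.
    move=> posg t; rewrite /= in_itv/= andbT => t1.
    by rewrite lee_fin divr_ge0 ?sqr_ge0// posg// (le_trans ler01).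
  apply: (@le_lt_trans _ _
    (k^-1%:E * \int[lebesgue_measure]_(t in `[1%R, +oo[) (w t / t ^+ 2)%:E)%E).
  + rewrite -ge0_integralZl_EFin//; last 3 first.
    * exact: ge0.
    * exact: measurable_ratio_sqr.
    * by rewrite invr_ge0 ltW.
    apply: ge0_le_integral => //.
    * exact: ge0.
    * exact: measurable_ratio_sqr.
    * by apply: measurable_funeM; exact: measurable_ratio_sqr.
    move=> t; rewrite /= in_itv/= andbT => t1.
    rewrite lee_fin mulrA ler_wpM2r ?invr_ge0 ?sqr_ge0// ler_pdivlMl//.
    by case: (fw t (le_trans ler01 t1)).
  + by apply: lte_mul_pinfty => //; rewrite lee_fin invr_ge0 ltW.
- apply: (@ger_cvgy _ _ _ _ (fun t => m^-1 * (w t / ln (1 + t)))); last first.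
    by apply: gt0_cvgMry => //; rewrite invr_gt0.
  near=> t; have t0 : 0 <= t by near: t; exact: nbhs_pinfty_ge.
  rewrite mulrA ler_wpM2r ?invr_ge0 ?ln_ge0 ?lerDl// ler_pdivrMl//.
  by case: (fw t t0).
Unshelve. all: by end_near. Qed.

(** * The least concave majorant *)

(** The pair c stands for the affine function s |-> c.1 + c.2 * s.  The signs
    of the intercept and of the slope are imposed because they yield,
    respectively, a decreasing ratio and an increasing infimum. *)
Definition affine_majorant (R : realType) (w : R -> R) (c : R * R) : Prop :=
  [/\ 0 <= c.1, 0 <= c.2 & forall s, 0 <= s -> w s <= c.1 + c.2 * s].

Definition concave_majorant (R : realType) (w : R -> R) (t : R) : R :=
  inf [set c.1 + c.2 * t | c in affine_majorant R w].

Section ConcaveMajorant.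
Context (R : realType) (w : R -> R) (ww : weight w).
Local Notation f := (concave_majorant R w).

(** These majorants make the infimum range over a nonempty set and, evaluated
    at the same point t, give 2 * w t. *)
Lemma weight_affine_majorant t : 0 < t -> affine_majorant R w (w t, w t / t).
Proof.
case: ww => posw incw cw w0 subw _ _ t0.
have wt0 : 0 <= w t by exact/posw/ltW.
split=> //=; first by rewrite divr_ge0// ltW.
by move=> s s0; exact: subadditive_le_affine.
Qed.

Lemma concave_majorant_le_affine c t :
  0 <= t -> affine_majorant R w c -> f t <= c.1 + c.2 * t.
Proof.
move=> t0 cw; apply: ge_inf; last by exists c.
by exists (w t) => _ [d [_ _ wd] <-]; exact: wd.
Qed.

Lemma le_concave_majorant z t :
  (forall c, affine_majorant R w c -> z <= c.1 + c.2 * t) -> z <= f t.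
Proof.
move=> zle; apply: lb_le_inf; last by move=> _ [c cw <-]; exact: zle.
by eexists; exists (w 1, w 1 / 1) => //; exact: weight_affine_majorant.
Qed.

Lemma weight_le_concave_majorant t : 0 <= t -> w t <= f t.
Proof. by move=> t0; apply: le_concave_majorant => c [_ _]; exact. Qed.

Lemma concave_majorant_le_double t : 0 < t -> f t <= 2 * w t.
Proof.
move=> t0; have := concave_majorant_le_affine _ _ (ltW t0)
  (weight_affine_majorant _ t0).
move=> /le_trans; apply => /=.
by rewrite mulfVK ?gt_eqF// mulr_natl mulr2n.
Qed.

Lemma concave_majorant_positive : positive_on_Rplus f.
Proof.
move=> t t0; apply: le_trans (weight_le_concave_majorant _ t0).
exact: weight_positive ww _ _.
Qed.

Lemma concave_majorant_increasing : increasing_on_Rplus f.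
Proof.
move=> x y; rewrite !in_itv/= !andbT => x0 y0 xy.
apply: le_concave_majorant => c cw.
apply: le_trans (concave_majorant_le_affine _ _ x0 cw) _; case: cw => _ c2 _.
by rewrite lerD2l ler_wpM2l.
Qed.

(** The bound f <= 2 * w is available only for t > 0, so the behaviour of f at 0
    has to be obtained from small positive points, where continuity makes w
    small; monotonicity then carries it to 0. *)
Lemma concave_majorant_small e : 0 < e -> exists2 d, 0 < d & f d <= e.
Proof.
move=> e0; have /continuous_within_itvcyP[_] := weight_continuous ww.
rewrite (weight_at0 ww) => /cvgrPdist_le/(_ (e / 2)) /= wsmall.
near (0 : R)^'+ => d; have d0 : 0 < d by near: d; exact: nbhs_right_gt.
exists d => //; apply: le_trans (concave_majorant_le_double _ d0) _.
rewrite -ler_pdivlMl// mulrC; apply: le_trans (ler_norm _) _.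
rewrite -normrN -sub0r; near: d; apply: wsmall; exact: divr_gt0.
Unshelve. all: by end_near. Qed.

Lemma concave_majorant0 : f 0 = 0.
Proof.
apply/eqP; rewrite eq_le concave_majorant_positive// andbT.
apply/ler_addgt0Pl => e e0.
rewrite addr0; have [d d0] := concave_majorant_small _ e0; apply: le_trans.
by apply: concave_majorant_increasing; rewrite ?in_itv/= ?lexx// ltW.
Qed.

Lemma concave_majorant_concave : concave_on_Rplus f.
Proof.
move=> t x y; rewrite !inE/= !in_itv/= !andbT => x0 y0.
rewrite convRE; set u := t%:num; set v := unstable.onem u.
have u0 : 0 <= u by rewrite /u.
have v0 : 0 <= v by rewrite /v /u unstable.onem_ge0.
suff : u * f x + v * f y <= f (u * x + v * y).
  by rewrite -lerN2 opprD -!mulrN.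
apply: le_concave_majorant => c cw.
apply: le_trans (lerD (ler_wpM2l u0 (concave_majorant_le_affine _ _ x0 cw))
                      (ler_wpM2l v0 (concave_majorant_le_affine _ _ y0 cw))) _.
rewrite [leLHS](_ : _ = c.1 + c.2 * (u * x + v * y))//.
by rewrite /v /unstable.onem; ring.
Qed.

(** For a single majorant, (a + b * t) / t = a / t + b is decreasing because
    a >= 0, and this survives the infimum.  The inequality is used with the
    denominators cleared. *)
Lemma concave_majorant_ratio_decreasing : ratio_decreasing f.
Proof.
move=> x y; rewrite !in_itv/= !andbT => x0 y0 xy.
rewrite ler_pdivrMr// mulrAC ler_pdivlMr// -ler_pdivrMr//.
apply: le_concave_majorant => c cw; rewrite ler_pdivrMr//.
have := concave_majorant_le_affine _ _ (ltW y0) cw.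
move=> /(ler_wpM2r (ltW x0))/le_trans; apply.
case: cw => c1 _ _; rewrite !mulrDl mulrAC lerD2r.
by rewrite ler_wpM2l.
Qed.

Lemma concave_majorant_weak_class : weak_class w f.
Proof.
have wf : forall t, 0 <= t -> 1 * w t <= f t /\ f t <= 2 * w t.
  move=> t; rewrite mul1r le_eqVlt => /predU1P[<-|t0].
    by rewrite concave_majorant0 (weight_at0 ww) mulr0; split.
  split; first exact/weight_le_concave_majorant/ltW.
  exact: concave_majorant_le_double.
split; last by exists 1, 2.
apply: (weight_of_ratio_decreasing _ _ _ concave_majorant_positive _
  concave_majorant0 ww).
- apply: subadditive_continuous concave_majorant_increasing _
    concave_majorant_small.
  apply: ratio_decreasing_subadditive concave_majorant0 _.
  exact: concave_majorant_ratio_decreasing.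
- exists 2^-1, 1; split=> // t t0; have [wt ft] := wf t t0.
  by split; [rewrite ler_pdivrMl|move: wt; rewrite !mul1r].
- exact: concave_majorant_increasing.
- exact: concave_majorant_ratio_decreasing.
Qed.

End ConcaveMajorant.

Theorem theorem2p2 (R : realType) :
  ((forall w : R -> R, weight w ->
      exists f : R -> R,
        [/\ weak_class w f, increasing_on_Rplus f & ratio_decreasing f])
   /\
   (forall f : R -> R,
      positive_on_Rplus f -> continuous_on_Rplus f -> f 0 = 0 ->
      (exists w : R -> R, weight w /\ weakly_equivalent f w) ->
      increasing_on_Rplus f -> ratio_decreasing f ->
      weight f))
  /\
  (forall w : R -> R, weight w ->
     exists f : R -> R, weak_class w f /\ concave_on_Rplus f).
Proof.
split; [split|].
- move=> w ww; exists (concave_majorant R w); split.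
  + exact: concave_majorant_weak_class.
  + exact: concave_majorant_increasing.
  + exact: concave_majorant_ratio_decreasing.
- move=> f posf cf f0 [w [ww fw]].
  exact: weight_of_ratio_decreasing posf cf f0 ww fw.
- move=> w ww; exists (concave_majorant R w); split.
  + exact: concave_majorant_weak_class.
  + exact: concave_majorant_concave.
Qed.
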